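(* Let $q$ be a prime power, $k\ge1$ an integer, $d$ an even integer with $2\le d\le 2k$, and let $\bar n=(n_1,\dots,n_l)\in\mathbb{N}^l$, where $l\ge 2$, be such that $\sum_{i=1}^l n_i=n$ and $n_i\ge k$ for all $1\le i\le l$. For $1\le i\le l$ let $\mathcal{C}_i$ be an $(n_i,\star,d;k)_q$-CDC and let $\mathcal{M}_i$ be a $(k\times n_i,\tfrac d2)_q$-rank metric code. Set $\mathcal{C}=\bigcup_{i=1}^l\mathcal{C}^i$, where $$\begin{aligned}\mathcal{C}^i=\Big\{R\left(M_1|\dots|M_{i-1}|\tau(U_i)|M_{i+1}|\dots|M_l\right)\,:\;& U_i\in\mathcal{C}_i,\ M_j\in\mathcal{M}_j\ \forall\,1\le j\le l,\ j\neq i,\\ &\text{and } \operatorname{rk}(M_j)\le k-\tfrac d2\ \forall\,1\le j<i\Big\}.\end{aligned}$$ Then $\mathcal{C}$ is an $(n,\star,d;k)_q$-CDC of cardinality $$\#\mathcal{C}=\sum_{i=1}^l\left(\prod_{j=1}^{i-1}\#\left\{M\in\mathcal{M}_j\,:\,\operatorname{rk}(M)\le k-\tfrac d2\right\}\right)\cdot\#\mathcal{C}_i\cdot\left(\prod_{j=i+1}^{l}\#\mathcal{M}_j\right).$$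
   Context: The subspace distance between subspaces $U,U'$ of $\mathbb{F}_q^n$ is $d(U,U')=\dim(U+U')-\dim(U\cap U')$. An $(n,\star,d;k)_q$-CDC (constant-dimension code) is a set of $k$-dimensional subspaces of $\mathbb{F}_q^n$ any two distinct elements of which have subspace distance at least $d$; $\star$ means that the cardinality is not specified. A $(k\times m,\delta)_q$-rank metric code is a set of matrices in $\mathbb{F}_q^{k\times m}$ such that $\operatorname{rk}(M-M')\ge\delta$ for any two distinct elements $M,M'$. $R(M)$ denotes the row space of a matrix $M$, $(A|B|\dots)$ denotes horizontal concatenation of matrices, and $\tau(U)$ denotes the unique full-rank $k\times m$ matrix in reduced row echelon form whose row space is the $k$-dimensional subspace $U\le\mathbb{F}_q^m$. *)

(* Defs.v *)
From HB Require Import structures.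
From mathcomp Require Import all_boot all_order all_algebra.

Set Implicit Arguments.
Unset Strict Implicit.
Unset Printing Implicit Defensive.

Import GRing.Theory.
Local Open Scope ring_scope.

(* A subspace is stored as its canonical square matrix, so over a finite field
   there are finitely many of them and codes can be taken in {set {vspace _}}. *)
Section FinVspace.
Import VectorInternalTheory. (* the subtype structure of {vspace _} *)
Variables (F : finFieldType) (vT : vectType F).
HB.instance Definition _ := [Countable of {vspace vT} by <:].
HB.instance Definition _ := [Finite of {vspace vT} by <:].
End FinVspace.

(* The truncated subtraction is exact, as U :&: V is contained in U + V. *)
Definition subspace_dist (F : fieldType) (n : nat) (U V : {vspace 'rV[F]_n}) : nat :=
  (\dim (U + V)%VS - \dim (U :&: V)%VS)%N.

Definition is_CDC (F : finFieldType) (n d k : nat)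
    (C : {set {vspace 'rV[F]_n}}) : Prop :=
  (forall U, U \in C -> \dim U = k) /\
  (forall U V, U \in C -> V \in C -> U != V -> (d <= subspace_dist U V)%N).

Definition is_RMC (F : finFieldType) (k m delta : nat)
    (C : {set 'M[F]_(k, m)}) : Prop :=
  forall M N, M \in C -> N \in C -> M != N -> (delta <= \rank (M - N)%R)%N.

Definition rowspace (F : fieldType) (k m : nat) (M : 'M[F]_(k, m)) :
    {vspace 'rV[F]_m} :=
  <<[seq row i M | i : 'I_k]>>%VS.

(* Column of the first nonzero entry of row i; equal to m if that row is zero. *)
Definition lead_col (F : fieldType) (k m : nat) (M : 'M[F]_(k, m)) (i : 'I_k) : nat :=
  find (fun j : 'I_m => M i j != 0) (enum 'I_m).

(* The first clause also forces the zero rows to be at the bottom: a nonzero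
   row i' has lead_col M i' < m, so every earlier row is nonzero as well. *)
Definition is_rref (F : fieldType) (k m : nat) (M : 'M[F]_(k, m)) : bool :=
  [forall i : 'I_k, forall i' : 'I_k,
     (i < i')%N && (row i' M != 0) ==> (lead_col M i < lead_col M i')%N] &&
  [forall i : 'I_k, forall i' : 'I_k, forall j : 'I_m,
     (j == lead_col M i :> nat) ==> (M i' j == (i' == i)%:R)].

(* Meaningful when \dim U = k, in which case exactly one matrix qualifies. *)
Definition tau (F : finFieldType) (k m : nat) (U : {vspace 'rV[F]_m}) :
    'M[F]_(k, m) :=
  odflt 0 [pick T : 'M[F]_(k, m) |
             [&& is_rref T, \rank T == k & rowspace T == U]].

Section GeneralizedLinkage.

Variables (F : finFieldType) (k d l : nat) (n_ : 'I_l -> nat).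
Variable C_ : forall i : 'I_l, {set {vspace 'rV[F]_(n_ i)}}.
Variable M_ : forall i : 'I_l, {set 'M[F]_(k, n_ i)}.

(* The row space of (M_1|...|tau(U)|...|M_l), with tau(U) in position i. *)
Definition linkage_space (i : 'I_l) (U : {vspace 'rV[F]_(n_ i)})
    (M : {dffun forall j : 'I_l, 'M[F]_(k, n_ j)}) :
    {vspace 'rV[F]_(\sum_(j < l) n_ j)} :=
  rowspace (\mxrow_(j < l) dfwith M (tau k U) j).

(* The component M i is discarded by linkage_space and left unconstrained. *)
Definition linkage_families (i : 'I_l) :
    {set {dffun forall j : 'I_l, 'M[F]_(k, n_ j)}} :=
  [set M : {dffun forall j : 'I_l, 'M[F]_(k, n_ j)} |
    [forall j : 'I_l, (j != i) ==> (M j \in M_ j)] &&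
    [forall j : 'I_l, (j < i)%N ==> (\rank (M j) <= k - d./2)%N]].

Definition linkage_part (i : 'I_l) : {set {vspace 'rV[F]_(\sum_(j < l) n_ j)}} :=
  [set linkage_space U M | U in C_ i, M in linkage_families i].

Definition linkage : {set {vspace 'rV[F]_(\sum_(j < l) n_ j)}} :=
  \bigcup_(i < l) linkage_part i.

End GeneralizedLinkage.

(* Main.v *)
Require Import Defs.
From HB Require Import structures.
From mathcomp Require Import all_boot all_order all_algebra.
From mathcomp Require Import perm zify.

(** The subspaces involved all have dimension k, so d(V, V') = 2k - 2 dim(V :&: V'),
    and for even d the condition d <= d(V, V') says dim(V :&: V') <= k - d/2
    ([leq_subspace_dist]).  The whole theorem is thus about dimensions of
    intersections.  They are bounded by restricting to the columns of one block i.
    If that block has full row rank k in a matrix A, the restriction is injective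
    on the row space of A; hence for any B the intersection of the row spaces of A
    and B is no larger than that of the row spaces of their i-th blocks
    ([mxrank_capM]).  If moreover A and B have the same i-th block, a common vector
    x A = y B forces x = y, so x (A - B) = 0, and the intersection has dimension at
    most k - rk(A - B) ([mxrank_cap_sub]).

    Let V and V' be two members of the linkage code.
    - If they come from positions i < i', block i of V is tau(U_i) and block i of
      V' has rank at most k - d/2: this bounds the intersection.
    - If they come from the same position i and from U <> U', the i-th blocks span
      U and U', whose intersection is small because C_i is a code.
    - If they come from the same i and the same U, some block j <> i differs, and
      the two matrices there are at rank distance at least d/2.
    Since k - d/2 < k, the same bounds show that the parts are pairwise disjoint and
    that distinct data give distinct subspaces, whence the cardinality.

    All this needs tau(U) to be a matrix of rank k with row space U, i.e. the
    existence of reduced row echelon forms ([exists_echelon_form]).  Pivot columns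
    are found by an extremal argument instead of elimination: among the maps p for
    which the columns p 0, ..., p (k-1) of A form an invertible matrix, one that
    minimizes a suitable weighted sum of the p i gives increasing pivots, and zeros
    to the left of them. *)

Import GRing.Theory.
Local Open Scope ring_scope.

(** * Reduced row echelon forms *)

(** The map p lists the pivot columns of the reduced row echelon form P *m A. *)
Lemma exists_echelon_form {F : fieldType} {k m : nat} (A : 'M[F]_(k, m)) :
  row_free A ->
  exists (P : 'M[F]_k) (p : 'I_k -> 'I_m),
    [/\ P \in unitmx,
        forall i i' : 'I_k, (i < i')%N -> (p i < p i')%N,
        forall i i' : 'I_k, (P *m A) i' (p i) = (i' == i)%:R &
        forall (i : 'I_k) (j : 'I_m), (j < p i)%N -> (P *m A) i j = 0].
Proof.
move=> freeA.
have fullAT : row_full A^T by rewrite /row_full mxrank_tr.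
pose good (p : {ffun 'I_k -> 'I_m}) := colsub p A \in unitmx.
have good0 : good (fullrankfun fullAT).
  by rewrite /good -unitmx_tr trmx_mxsub; exact: fullrowsub_unit.
(* The positive decreasing coefficients k - i make the weight drop both when some
   p i is lowered and when an inversion of p is removed by a swap. *)
pose weight (p : {ffun 'I_k -> 'I_m}) := (\sum_(i < k) (k - i) * p i)%N.
case: (arg_minnP weight good0) => p; rewrite /good => pU pmin.
set P := invmx (colsub p A).
have colPA (q : 'I_k -> 'I_m) : colsub q (P *m A) = P *m colsub q A.
  by rewrite mulmx_colsub.
have Ppiv i i' : (P *m A) i' (p i) = (i' == i)%:R.
  have /matrixP/(_ i' i) := colPA p.
  by rewrite /P mulVmx // !mxE.
exists P, p; split=> //.
- by rewrite unitmx_inv.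
- move=> i i' lt_ii'; rewrite ltnNge; apply/negP => le_p.
  have neq_ii' : i' != i by apply: contraTneq lt_ii' => ->; rewrite ltnn.
  have {le_p} lt_p : (p i' < p i)%N.
    rewrite ltn_neqAle le_p andbT; apply/eqP => /val_inj eq_p.
    have := Ppiv i i; rewrite -eq_p Ppiv eqxx eq_sym (negPf neq_ii') => /eqP.
    by rewrite eq_sym oner_eq0.
  (* Swapping p i and p i' would lower the weight. *)
  pose q := [ffun x => p (tperm i i' x)].
  have qU : colsub q A \in unitmx.
    have -> : colsub q A = col_perm (tperm i i') (colsub p A).
      by apply/matrixP => x y; rewrite !mxE ffunE.
    by rewrite col_permE unitmx_mul pU unitmx_perm.
  have := pmin q qU; rewrite /weight.
  rewrite (bigD1 i) //= (bigD1 i') //= [X in (_ <= X)%N](bigD1 i) //=.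
  rewrite [X in (_ <= _ + X)%N](bigD1 i') //= !ffunE tpermL tpermR.
  have -> : (\sum_(j < k | (j != i) && (j != i')) (k - j) * p j =
             \sum_(j < k | (j != i) && (j != i')) (k - j) * q j)%N.
    by apply: eq_bigr => j /andP[ji ji']; rewrite ffunE tpermD // eq_sym.
  rewrite !addnA leq_add2r.
  have : (k - i' < k - i)%N by rewrite ltn_sub2l // (leq_trans lt_ii') // ltnW.
  move: (p i : nat) (p i' : nat) (k - i)%N (k - i')%N lt_p => a b u w.
  nia.
- move=> i j lt_j; apply/eqP; apply: contraTT lt_j => nz; rewrite -leqNgt.
  (* The submatrix of P *m A on the columns q is the identity with column i replaced
     by one whose diagonal entry is nonzero; so q is admissible, and lighter. *)
  pose q := [ffun x => if x == i then j else p x].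
  have qU : colsub q A \in unitmx.
    suff: P *m colsub q A \in unitmx by rewrite unitmx_mul => /andP[].
    rewrite -colPA -row_free_unit; apply: inj_row_free => v v0.
    have entry0 x : \sum_y v 0 y * (P *m A) y (q x) = 0.
      by have /rowP/(_ x) := v0; rewrite !mxE => {2}<-;
        apply: eq_bigr => y _; rewrite !mxE.
    have v0_out x : x != i -> v 0 x = 0.
      move=> xi; rewrite -[RHS](entry0 x) (bigD1 x) //= ffunE (negPf xi) Ppiv eqxx mulr1.
      by rewrite big1 ?addr0 // => y /negPf yx; rewrite Ppiv yx mulr0.
    apply/rowP => x; rewrite mxE; have [->|/v0_out //] := eqVneq x i.
    have := entry0 i; rewrite (bigD1 i) //= ffunE eqxx.
    rewrite big1 => [|y /v0_out ->]; last by rewrite mul0r.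
    by move/eqP; rewrite addr0 mulf_eq0 (negPf nz) orbF => /eqP.
  have := pmin q qU; rewrite /weight.
  rewrite (bigD1 i) //= [X in (_ <= X)%N](bigD1 i) //= ffunE eqxx.
  have -> : (\sum_(x < k | x != i) (k - x) * p x =
             \sum_(x < k | x != i) (k - x) * q x)%N.
    by apply: eq_bigr => x /negPf xi; rewrite ffunE xi.
  by rewrite leq_add2r leq_pmul2l // subn_gt0 ltn_ord.
Qed.

(** * Row spaces *)

Lemma mem_rowspace {F : fieldType} {k m : nat} (M : 'M[F]_(k, m)) (v : 'rV_m) :
  (v \in rowspace M) = (v <= M)%MS.
Proof.
apply/idP/idP => [|/submxP[x ->]]; last first.
  rewrite mulmx_sum_row; apply: memv_suml => i _.
  by apply: memvZ; apply: memv_span; apply: image_f.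
pose X := codom_tuple (fun i => row i M).
rewrite -[rowspace M]/(<<X>>%VS) => /coord_span ->.
apply: summx_sub => i _; apply: scalemx_sub.
by rewrite -tnth_nth tnth_map row_sub.
Qed.

Lemma dim_rowspace {F : fieldType} {k m : nat} (M : 'M[F]_(k, m)) :
  \dim (rowspace M) = \rank M.
Proof.
have -> : rowspace M = rowspace (row_base M).
  by apply/vspaceP => v; rewrite !mem_rowspace eq_row_base.
pose X := codom_tuple (fun i => row i (row_base M)).
suff freeX : free X by rewrite [LHS](eqP freeX) size_tuple card_ord.
have X_row (i : 'I_#|'I_(\rank M)|) : X`_i = row (enum_val i) (row_base M).
  by rewrite -tnth_nth tnth_map (tnth_nth (enum_val i)) /= -enum_val_nth.
apply/freeP => c c0 i.
pose c' := \row_j c (enum_rank j).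
have c'0 : c' *m row_base M = 0.
  rewrite mulmx_sum_row -[RHS]c0 (reindex_onto enum_val enum_rank) /=; last first.
    by move=> j _; rewrite enum_rankK.
  by apply: eq_big => [j|j _]; rewrite ?enum_valK ?eqxx // X_row mxE enum_valK.
have /rowP/(_ (enum_val i)) : c' = 0.
  by apply: (row_free_inj (row_base_free M)); rewrite mul0mx.
by rewrite !mxE enum_valK.
Qed.

Lemma rowspace_cap {F : fieldType} {k k' m : nat} (A : 'M[F]_(k, m)) (B : 'M_(k', m)) :
  rowspace (A :&: B)%MS = (rowspace A :&: rowspace B)%VS.
Proof. by apply/vspaceP => v; rewrite memv_cap !mem_rowspace sub_capmx. Qed.

Lemma rowspace_surj {F : fieldType} {k m : nat} (U : {vspace 'rV[F]_m}) :
  \dim U = k -> exists A : 'M[F]_(k, m), rowspace A = U.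
Proof.
move=> <-; exists (\matrix_(i < \dim U) (vbasis U)`_i).
apply/vspaceP => v; rewrite mem_rowspace; apply/submxP/idP => [[x ->]|/coord_vbasis ->].
  rewrite mulmx_sum_row; apply: memv_suml => i _.
  by rewrite rowK memvZ // vbasis_mem // mem_nth // size_tuple.
exists (\row_i coord (vbasis U) i v).
by rewrite mulmx_sum_row; apply: eq_bigr => i _; rewrite rowK mxE.
Qed.

(** * The matrix tau of a subspace *)

Lemma lead_colE {F : fieldType} {k m : nat} (M : 'M[F]_(k, m)) (i : 'I_k) (j : 'I_m) :
  M i j != 0 -> (forall j' : 'I_m, (j' < j)%N -> M i j' = 0) -> lead_col M i = j.
Proof.
move=> nz z; rewrite /lead_col; set a := fun _ => _.
have has_a : has a (enum 'I_m) by apply/hasP; exists j; rewrite ?mem_enum.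
have lt_f : (find a (enum 'I_m) < m)%N.
  by rewrite -[X in (_ < X)%N](size_enum_ord m) -has_find.
case: (ltngtP (find a (enum 'I_m)) j) => // [lt|gt].
- by have := nth_find j has_a; rewrite /a z ?eqxx // nth_enum_ord.
- by have := before_find j gt; rewrite nth_ord_enum /a (negPf nz).
Qed.

Lemma tau_exists {F : finFieldType} {k m : nat} (U : {vspace 'rV[F]_m}) :
  \dim U = k ->
  exists T : 'M[F]_(k, m), [&& is_rref T, \rank T == k & rowspace T == U].
Proof.
move=> dimU; have [A eqAU] := rowspace_surj _ dimU.
have rkA : row_free A.
  by rewrite /row_free -dim_rowspace eqAU dimU.
have [P [p [PU p_incr piv before]]] := exists_echelon_form _ rkA.
set T := P *m A in piv before *.
have lead i : lead_col T i = p i.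
  apply: lead_colE; [by rewrite piv eqxx oner_eq0|exact: before].
have eqTA : (T :=: A)%MS by apply: eqmxMfull; rewrite row_full_unit.
exists T; apply/and3P; split.
- apply/andP; split; apply/forallP => i; apply/forallP => i'.
    by apply/implyP => /andP[lt_ii' _]; rewrite !lead; apply: p_incr.
  apply/forallP => j; apply/implyP; rewrite lead => /eqP /val_inj ->.
  by rewrite piv.
- by rewrite eqTA.
- by rewrite -eqAU; apply/eqP/vspaceP => v; rewrite !mem_rowspace eqTA.
Qed.

Lemma tauP {F : finFieldType} {k m : nat} (U : {vspace 'rV[F]_m}) :
  \dim U = k -> rowspace (tau k U) = U /\ row_free (tau k U).
Proof.
move=> dimU; have [T0 T0P] := tau_exists U dimU.
rewrite /tau; case: pickP => [T /and3P[_ rkT /eqP]//|/(_ T0)]; by rewrite T0P.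
Qed.

(** * Intersections of row spaces *)

(** The map x |-> x E is injective on the row space of A, and it sends the common
    vectors of A and B to common vectors of A E and B E. *)
Lemma mxrank_capM {F : fieldType} {k k' n p : nat}
    (A : 'M[F]_(k, n)) (B : 'M_(k', n)) (E : 'M_(n, p)) :
  row_free (A *m E) -> (\rank (A :&: B)%MS <= \rank (A *m E :&: B *m E)%MS)%N.
Proof.
move=> freeAE.
have freeA : row_free A.
  by rewrite /row_free eqn_leq rank_leq_row -{1}(eqP freeAE) mxrankM_maxl.
have /submxP[X defW] := capmxSl A B.
have -> : \rank (A :&: B)%MS = \rank ((A :&: B)%MS *m E).
  by rewrite defW -mulmxA !mxrankMfree.
by apply: mxrankS; rewrite sub_capmx !submxMr ?capmxSl ?capmxSr.
Qed.

(** Since A E = B E has independent rows, a common vector x A = y B has x = y, so x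
    is in the left kernel of A - B. *)
Lemma mxrank_cap_sub {F : fieldType} {k n p : nat}
    (A B : 'M[F]_(k, n)) (E : 'M_(n, p)) :
  row_free (A *m E) -> A *m E = B *m E ->
  (\rank (A :&: B)%MS <= k - \rank (A - B)%R)%N.
Proof.
move=> freeAE eqE.
have /submxP[X defX] := capmxSl A B.
have /submxP[Y defY] := capmxSr A B.
have eqXY : X = Y.
  by apply: (row_free_inj freeAE); rewrite {2}eqE !mulmxA -defX -defY.
have X0 : X *m (A - B) = 0 by rewrite mulmxBr -defX {1}defY eqXY subrr.
have := mulmx0_rank_max X0.
rewrite defX; have := mxrankM_maxl X A; lia.
Qed.

Lemma leq_subspace_dist {F : fieldType} {n : nat} (d k : nat) (U V : {vspace 'rV[F]_n}) :
  ~~ odd d -> (d <= 2 * k)%N -> \dim U = k -> \dim V = k ->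
  (d <= subspace_dist U V)%N = (\dim (U :&: V) <= k - d./2)%N.
Proof.
move=> d_even d_le dimU dimV; rewrite /subspace_dist.
have := dimv_sum_cap U V; have := dimvS (capvSl U V); rewrite dimU dimV.
move: (\dim _) (\dim _) => c s; lia.
Qed.

(** * Intersections of linkage spaces *)

Section LinkageSpaces.

Context {F : finFieldType} {k l : nat} {n_ : 'I_l -> nat}.
Implicit Types M : {dffun forall j : 'I_l, 'M[F]_(k, n_ j)}.

(** Right multiplication by the j-th block column of the identity extracts block j. *)
Lemma mxrow_block (B : forall j, 'M[F]_(k, n_ j)) j :
  (\mxrow_j B j) *m submxrow 1%:M j = B j.
Proof. by rewrite mul_submxrow mulmx1 mxrowK. Qed.

Lemma dim_linkage_space i (U : {vspace 'rV_(n_ i)}) M :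
  \dim U = k -> \dim (linkage_space U M) = k.
Proof.
move=> /tauP[_ freeT]; rewrite dim_rowspace; apply/eqP.
rewrite eqn_leq rank_leq_row -{1}(eqP freeT) -{1}(dfwith_in M (tau k U)).
by rewrite -{1}mxrow_block mxrankM_maxl.
Qed.

Lemma linkage_space_cap_le_rank i i' (U : {vspace 'rV_(n_ i)})
    (U' : {vspace 'rV_(n_ i')}) M M' :
  \dim U = k -> i != i' ->
  (\dim (linkage_space U M :&: linkage_space U' M') <= \rank (M' i))%N.
Proof.
move=> /tauP[_ freeT] neq_ii'; rewrite -rowspace_cap dim_rowspace.
apply: leq_trans (mxrank_capM _ _ (submxrow 1%:M i) _) _.
  by rewrite mxrow_block dfwith_in.
by rewrite !mxrow_block (dfwith_out M' (tau k U')) 1?eq_sym // mxrankS ?capmxSr.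
Qed.

Lemma linkage_space_cap_le_dim i (U U' : {vspace 'rV_(n_ i)}) M M' :
  \dim U = k -> \dim U' = k ->
  (\dim (linkage_space U M :&: linkage_space U' M') <= \dim (U :&: U'))%N.
Proof.
move=> /tauP[eqT freeT] /tauP[eqT' _]; rewrite -rowspace_cap dim_rowspace.
apply: leq_trans (mxrank_capM _ _ (submxrow 1%:M i) _) _.
  by rewrite mxrow_block dfwith_in.
by rewrite !mxrow_block !dfwith_in -dim_rowspace rowspace_cap eqT eqT'.
Qed.

Lemma linkage_space_cap_le_sub i j (U : {vspace 'rV_(n_ i)}) M M' :
  \dim U = k -> j != i ->
  (\dim (linkage_space U M :&: linkage_space U M') <= k - \rank (M j - M' j)%R)%N.
Proof.
move=> /tauP[_ freeT] neq_ji; rewrite -rowspace_cap dim_rowspace.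
apply: leq_trans (mxrank_cap_sub _ _ (submxrow 1%:M i) _ _) _.
- by rewrite mxrow_block dfwith_in.
- by rewrite !mxrow_block !dfwith_in.
apply: leq_sub2l.
have -> : M j - M' j =
    (\mxrow_j dfwith M (tau k U) j - \mxrow_j dfwith M' (tau k U) j) *m submxrow 1%:M j.
  by rewrite mulmxBl !mxrow_block !dfwith_out // eq_sym.
exact: mxrankM_maxl.
Qed.

Lemma eq_linkage_space i (U : {vspace 'rV_(n_ i)}) M M' :
  (forall j, j != i -> M j = M' j) -> linkage_space U M = linkage_space U M'.
Proof.
move=> eqM; rewrite /linkage_space; congr (rowspace _); apply: eq_mxrow => j.
by case: dfwithP => [|j' /[1!eq_sym] ne]; rewrite ?dfwith_in ?dfwith_out 1?eq_sym // eqM.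
Qed.

End LinkageSpaces.

(** * Distance and cardinality of the linkage code *)

Section LinkageCode.

Context {F : finFieldType} {k d l : nat} {n_ : 'I_l -> nat}.
Context {C_ : forall i : 'I_l, {set {vspace 'rV[F]_(n_ i)}}}.
Context {M_ : forall i : 'I_l, {set 'M[F]_(k, n_ i)}}.
Implicit Types M : {dffun forall j : 'I_l, 'M[F]_(k, n_ j)}.
Context (d_even : ~~ odd d).
Context (d_le2k : (d <= 2 * k)%N).
Context (C_CDC : forall i : 'I_l, is_CDC d k (C_ i)).
Context (M_RMC : forall i : 'I_l, is_RMC d./2 (M_ i)).

Lemma linkage_parts_cap i i' U U' M M' :
  i != i' -> U \in C_ i -> U' \in C_ i' ->
  M \in linkage_families d M_ i -> M' \in linkage_families d M_ i' ->
  (\dim (linkage_space U M :&: linkage_space U' M') <= k - d./2)%N.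
Proof.
wlog lt_ii' : i i' U U' M M' / (i < i')%N.
  move=> wlog_lt neq_ii' CU CU' famM famM'.
  have [lt|lt|/val_inj eq_ii'] := ltngtP i i'; first exact: wlog_lt.
    by rewrite capvC; apply: wlog_lt; rewrite // eq_sym.
  by rewrite eq_ii' eqxx in neq_ii'.
move=> neq_ii' CU _ _; rewrite inE => /andP[_ /forallP/(_ i)/implyP/(_ lt_ii')].
apply: leq_trans; apply: linkage_space_cap_le_rank => //.
exact: (C_CDC i).1.
Qed.

(** Two data in the same part either agree, up to the ignored component i, or give
    spaces with a small intersection. *)
Lemma linkage_part_cap i U U' M M' :
  U \in C_ i -> U' \in C_ i ->
  M \in linkage_families d M_ i -> M' \in linkage_families d M_ i ->
  (U = U' /\ forall j, j != i -> M j = M' j) \/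
  (\dim (linkage_space U M :&: linkage_space U' M') <= k - d./2)%N.
Proof.
move=> CU CU'; rewrite !inE => /andP[/forallP famM _] /andP[/forallP famM' _].
have [dimC distC] := C_CDC i.
have [eqU|neqU] := eqVneq U U'; last first.
  right; apply: leq_trans (linkage_space_cap_le_dim _ _ _ _ _ _ _) _; try exact: dimC.
  by rewrite -leq_subspace_dist ?dimC // distC.
rewrite -{}eqU.
have [/existsP[j /andP[ji neqM]]|] := boolP [exists j, (j != i) && (M j != M' j)].
  right; apply: leq_trans (linkage_space_cap_le_sub _ j _ _ _ _ _) _ => //.
    exact: dimC.
  apply/leq_sub2l/M_RMC => //; [exact: implyP (famM j) ji|exact: implyP (famM' j) ji].
rewrite negb_exists => /forallP eqM; left; split=> // j ji.
by have := eqM j; rewrite ji negbK => /eqP.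
Qed.

Lemma linkage_CDC : is_CDC d k (linkage d C_ M_).
Proof.
have dimC i U : U \in C_ i -> \dim U = k by apply: (C_CDC i).1.
split=> [V /bigcupP[i _ /imset2P[U M CU _ ->]]|]; first exact/dim_linkage_space/(dimC i).
move=> V V' /bigcupP[i _ /imset2P[U M CU famM ->]].
move=> /bigcupP[i' _ /imset2P[U' M' CU' famM' ->]] neqV.
rewrite (leq_subspace_dist d k) ?dim_linkage_space ?(dimC _ _ CU) ?(dimC _ _ CU') //.
have [eq_ii'|neq_ii'] := eqVneq i i'; last exact: linkage_parts_cap.
subst i'; case: (linkage_part_cap i U U' M M') => // -[eqU eqM].
by case/eqP: neqV; rewrite -eqU; apply: eq_linkage_space.
Qed.

Context (d_gt0 : (0 < d)%N).

(** Spaces with a small intersection differ, since k - d/2 < k as d is positive. *)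
Lemma linkage_space_cap_neq i i' U U' M M' :
  U \in C_ i ->
  (\dim (linkage_space U M :&: linkage_space U' M') <= k - d./2)%N ->
  linkage_space U M = linkage_space (i := i') U' M' -> False.
Proof.
move=> CU le_cap eqV; move: le_cap; rewrite -eqV capvv dim_linkage_space; first lia.
exact: (C_CDC i).1.
Qed.

Lemma disjoint_linkage_parts i i' :
  i != i' -> [disjoint linkage_part d C_ M_ i & linkage_part d C_ M_ i'].
Proof.
move=> neq_ii'; apply/pred0P => V /=; apply/negbTE/negP => /andP[].
move=> /imset2P[U M CU famM ->] /imset2P[U' M' CU' famM' /linkage_space_cap_neq].
by apply=> //; apply: linkage_parts_cap.
Qed.

(** The matrices allowed in position j for the part with tau in position i.  Position
    i itself, which the linkage space ignores, is normalized to the zero matrix, so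
    that a linkage space determines its family. *)
Definition normal_family (i j : 'I_l) : {set 'M[F]_(k, n_ j)} :=
  if j == i then [set 0]
  else if (j < i)%N then [set M in M_ j | (\rank M <= k - d./2)%N] else M_ j.

Lemma in_normal_families i M :
  (M \in setXn (normal_family i)) = (M i == 0) && (M \in linkage_families d M_ i).
Proof.
rewrite in_setXn inE; apply/forallP/and3P => [famM|[Mi0 /forallP inM /forallP rkM] j].
  split; first by have := famM i; rewrite /normal_family eqxx inE.
    apply/forallP => j; apply/implyP => /negPf ji; have := famM j.
    by rewrite /normal_family ji; case: ifP => // _; rewrite inE => /andP[].
  apply/forallP => j; apply/implyP => lt_ji; have := famM j.
  rewrite /normal_family lt_ji; case: eqP lt_ji => [->|_ _]; first by rewrite ltnn.
  by rewrite inE => /andP[].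
rewrite /normal_family; have := implyP (inM j); have := implyP (rkM j).
case: eqVneq => [->|_ rkMj /(_ isT) inMj]; first by rewrite inE.
by case: ifP => // /rkMj; rewrite inE inMj.
Qed.

(** A parametrization of the i-th part that is injective, by
    [linkage_part_cap] and [linkage_space_cap_neq]. *)
Lemma linkage_partE i :
  linkage_part d C_ M_ i =
    [set linkage_space x.1 x.2 | x in setX (C_ i) (setXn (normal_family i))].
Proof.
apply/setP => V; apply/imset2P/imsetP => [[U M CU famM ->]|[[U M]]]; last first.
  by rewrite inE in_normal_families => /= /and3P[CU _ famM] ->; exists U M.
pose M0 : {dffun forall j, 'M[F]_(k, n_ j)} := [ffun j => if j == i then 0 else M j].
have M0E j : j != i -> M0 j = M j by move=> /negPf ji; rewrite ffunE ji.
exists (U, M0); last by apply: eq_linkage_space => j /M0E.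
rewrite inE in_normal_families CU /= ffunE !eqxx /=.
move: famM; rewrite !inE => /andP[/forallP inM /forallP rkM].
apply/andP; split; apply/forallP => j; apply/implyP => lt_j.
  by rewrite M0E //; exact: implyP (inM j) lt_j.
rewrite M0E; first exact: implyP (rkM j) lt_j.
by apply: contraTneq lt_j => ->; rewrite ltnn.
Qed.

Lemma card_linkage_part i :
  #|linkage_part d C_ M_ i| =
    (\prod_(j < l | j < i) #|[set M in M_ j | \rank M <= k - d./2]| * #|C_ i| *
     \prod_(j < l | i < j) #|M_ j|)%N.
Proof.
rewrite linkage_partE card_in_imset => [|[U M] [U' M']]; last first.
  rewrite !in_setX !in_normal_families /=.
  move=> /and3P[CU /eqP M0 famM] /and3P[CU' /eqP M'0 famM'].
  move/(linkage_space_cap_neq i i U U' M M' CU) => no_cap.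
  case: (linkage_part_cap i U U' M M') => // -[-> eqM].
  congr (_, _); apply/ffunP => j; have [->|/eqM //] := eqVneq j i.
  by rewrite M0 M'0.
rewrite cardsX cardsXn (bigD1 i) //= /normal_family eqxx cards1 mul1n.
rewrite (bigID (fun j : 'I_l => j < i)%N) /= [RHS]mulnAC mulnC; congr (_ * _ * _)%N.
  by apply: eq_big => [j|j /andP[/negPf -> ->]] //; case: eqVneq => // ->; rewrite ltnn.
apply: eq_big => [j|j /andP[/negPf -> /negPf ->]] //.
by rewrite -leqNgt ltn_neqAle eq_sym.
Qed.

End LinkageCode.

Theorem lemma4p1 (F : finFieldType) (k d l : nat) (n_ : 'I_l -> nat)
    (C_ : forall i : 'I_l, {set {vspace 'rV[F]_(n_ i)}})
    (M_ : forall i : 'I_l, {set 'M[F]_(k, n_ i)})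
    (k_ge1 : (1 <= k)%N)
    (d_even : ~~ odd d) (d_ge2 : (2 <= d)%N) (d_le2k : (d <= 2 * k)%N)
    (l_ge2 : (2 <= l)%N)
    (n_ge : forall i : 'I_l, (k <= n_ i)%N)
    (C_CDC : forall i : 'I_l, is_CDC d k (C_ i))
    (M_RMC : forall i : 'I_l, is_RMC d./2 (M_ i)) :
  is_CDC d k (linkage d C_ M_) /\
  #|linkage d C_ M_| =
    (\sum_(i < l)
       (\prod_(j < l | j < i) #|[set M in M_ j | \rank M <= k - d./2]|) *
       #|C_ i| *
       (\prod_(j < l | i < j) #|M_ j|))%N.
Proof.
have d_gt0 : (0 < d)%N by apply: leq_trans d_ge2.
split; first exact: linkage_CDC.
rewrite -sum1_card partition_disjoint_bigcup => [|i j]; last first.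
  exact: disjoint_linkage_parts.
by apply: eq_bigr => i _; rewrite sum1_card card_linkage_part.
Qed.
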